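(* Let $(X,d)$ be a metric space and let $\mathscr{B}$ be a bornology on $X$ with a closed base. If $(C(X),\mathscr{T}_{\mathscr{B}}^s)$ is a Baire space, then player $\beta$ does not have a winning strategy in the game $\mathscr{G}_{\mathscr{B}}^s(X)$.
   Context: A bornology $\mathscr{B}$ on a nonempty set $X$ is a family of nonempty subsets of $X$ that covers $X$ and is closed under taking finite unions and under taking (nonempty) subsets. It has a closed base if there is a subfamily $\mathscr{S}\subseteq\mathscr{B}$ of closed subsets of $X$ such that each $B\in\mathscr{B}$ is contained in some $A\in\mathscr{S}$. $C(X)$ is the set of continuous functions from $X$ to $\mathbb{R}$. For $\delta>0$ and $B\subseteq X$, $B^\delta=\bigcup_{b\in B}\{x\in X:d(x,b)<\delta\}$. The topology $\mathscr{T}_{\mathscr{B}}^s$ of strong uniform convergence on $\mathscr{B}$ is the topology on $C(X)$ induced by the uniformity having as a base of entourages all sets $[B;\varepsilon]^s=\{(f,g)\in C(X)\times C(X): \text{there is } \delta>0 \text{ such that } |f(x)-g(x)|<\varepsilon \text{ for all } x\in B^\delta\}$, where $B\in\mathscr{B}$ and $\varepsilon>0$. A space is Baire if every countable intersection of dense open subsets is dense. Nonempty sets $A,B\subseteq X$ are far from each other if $\inf\{d(a,b):a\in A,b\in B\}>0$. The game $\mathscr{G}_{\mathscr{B}}^s(X)$: players $\beta$ and $\alpha$ alternately choose members of $\mathscr{B}$. Player $\beta$ starts by choosing $B_1\in\mathscr{B}$, and $\alpha$ responds with $A_1\in\mathscr{B}$. At stage $n\ge2$, $\beta$ chooses $B_n\in\mathscr{B}$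 which is far from $A_{n-1}$, and $\alpha$ responds with $A_n\in\mathscr{B}$. Player $\alpha$ wins the play $\langle(B_n,A_n):n\ge1\rangle$ if the sequence $\langle B_n:n\ge1\rangle$ has an open discrete expansion in $X$, i.e. there are open sets $O_n\supseteq B_n$ such that the indexed family $\{O_n:n\ge1\}$ is discrete (each point of $X$ has a neighborhood meeting $O_n$ for at most one $n$); otherwise $\beta$ wins. A strategy for $\beta$ is a function assigning to each legal finite sequence (including the empty one) of moves of $\alpha$ a legal next move of $\beta$; it is winning if $\beta$ wins every play in which $\beta$ follows it. *)

(* Defs.v *)
From HB Require Import structures.
From mathcomp Require Import all_boot all_order all_algebra.
From mathcomp Require Import all_classical all_reals all_analysis.

Set Implicit Arguments.
Unset Strict Implicit.
Unset Printing Implicit Defensive.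

Import Order.TTheory GRing.Theory Num.Theory.
Import numFieldNormedType.Exports.

Local Open Scope classical_set_scope.
Local Open Scope ring_scope.

Record bornology (X : Type) := Bornology {
  born : set (set X);
  born_space_neq0 : [set: X] !=set0;
  born_neq0 : forall B, born B -> B !=set0;
  born_cover : \bigcup_(B in born) B = [set: X];
  born_setU : forall A B, born A -> born B -> born (A `|` B);
  born_subset : forall A B, born B -> A `<=` B -> A !=set0 -> born A
}.

Definition has_closed_base (X : topologicalType) (BB : bornology X) : Prop :=
  exists S : set (set X),
    [/\ S `<=` born BB, (forall A, S A -> closed A) &
        forall B, born BB B -> exists2 A, S A & B `<=` A].

Definition baire_space (T : topologicalType) : Prop :=
  forall U : nat -> set T,
    (forall n, open (U n) /\ dense (U n)) -> dense (\bigcap_n U n).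

Section StrongUniformConvergence.
Context {R : realType} {X : metricType R}.

Definition enlargement (B : set X) (delta : R) : set X :=
  \bigcup_(b in B) [set x | mdist x b < delta].

Definition strong_ent (B : set X) (eps : R) :
    set (continuousType X R * continuousType X R) :=
  [set fg : continuousType X R * continuousType X R |
     exists2 delta : R, 0 < delta & forall x,
       enlargement B delta x -> `|fg.1 x - fg.2 x| < eps].

(* Alias of C(X), indexed by the bornology so that it can carry the topology of
   strong uniform convergence on BB. *)
Definition strong_fun (BB : bornology X) : Type := continuousType X R.

HB.instance Definition _ (BB : bornology X) := gen_eqMixin (strong_fun BB).
HB.instance Definition _ (BB : bornology X) := gen_choiceMixin (strong_fun BB).

Section uniformity.
Variable BB : bornology X.

Definition strong_entourage : set_system (strong_fun BB * strong_fun BB) :=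
  filter_from [set Be : set X * R | born BB Be.1 /\ 0 < Be.2]
              (fun Be => strong_ent Be.1 Be.2).

Let strong_entourage_filter : Filter strong_entourage.
Proof.
apply: filter_from_filter.
  have [x _] := born_space_neq0 BB.
  have : [set: X] x by [].
  by rewrite -(born_cover BB) => -[B BBB _]; exists (B, 1); split => //=.
move=> [A e] [B d] /= [BBA e0] [BBB d0].
exists (A `|` B, Order.min e d) => /=.
  by split; [exact: born_setU | rewrite lt_min e0].
move=> [f g] /= [dl dl0 H]; split; exists dl => // x [b Hb xb].
- have /H : enlargement (A `|` B) dl x by exists b => //; left.
  by rewrite lt_min => /andP[].
- have /H : enlargement (A `|` B) dl x by exists b => //; right.
  by rewrite lt_min => /andP[].
Qed.

Let strong_entourage_diagonal A :
  strong_entourage A -> diagonal `<=` A.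
Proof.
move=> [[B e] /= [_ e0] sub] [f g] /= fg; apply: sub; exists 1 => //= x _.
by rewrite /= (fg : f = g) subrr normr0.
Qed.

Let strong_entourage_inv A :
  strong_entourage A -> strong_entourage (A^-1)%relation.
Proof.
move=> [[B e] /= Be sub]; exists (B, e) => // -[f g] /= [dl dl0 H].
by apply: sub; exists dl => //= x /H; rewrite distrC.
Qed.

Let strong_entourage_split A : strong_entourage A ->
  exists2 E, strong_entourage E & (E \; E `<=` A)%relation.
Proof.
move=> [[B e] /= [BBB e0] sub]; exists (strong_ent B (e / 2)).
  by exists (B, e / 2) => //=; split => //; rewrite divr_gt0.
move=> [f g] /= [h /= [d1 d10 H1] [d2 d20 H2]].
apply: sub; exists (Order.min d1 d2) => [|x [b Bb /=]]; rewrite lt_min ?d10//.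
move=> /andP[xb1 xb2]; rewrite (splitr e) -(subrKA (h x)).
rewrite (le_lt_trans (ler_normD _ _))// ltrD//.
  by apply: H1; exists b.
by apply: H2; exists b.
Qed.

HB.instance Definition _ := isUniform.Build (strong_fun BB)
  strong_entourage_filter strong_entourage_diagonal
  strong_entourage_inv strong_entourage_split.

End uniformity.
End StrongUniformConvergence.

Definition has_open_discrete_expansion (T : topologicalType)
    (B : nat -> set T) : Prop :=
  exists O : nat -> set T,
    [/\ forall n, open (O n), forall n, B n `<=` O n &
        forall x : T, exists2 V, nbhs x V &
          forall m n, O m `&` V !=set0 -> O n `&` V !=set0 -> m = n].

Section Game.
Context {R : realType} {X : metricType R}.

(* [inf] of the empty set is 0, so far sets are nonempty. *)
Definition far (A B : set X) : Prop :=
  0 < inf [set mdist a b | a in A & b in B].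

Variable BB : bornology X.

(* [As] lists the previous moves of alpha, in chronological order. *)
Definition beta_legal (As : seq (set X)) (B : set X) : Prop :=
  born BB B /\ (if As is A :: As' then far B (last A As') else True).

(* Every move of alpha in BB is legal, so the legal sequences of moves of alpha
   are the sequences in BB; values on other sequences are irrelevant. *)
Definition beta_strategy (sigma : seq (set X) -> set X) : Prop :=
  forall As, (forall A, A \in As -> born BB A) -> beta_legal As (sigma As).

(* Moves are numbered from 0: the n-th move of beta answers
   [:: As 0; ...; As n.-1]. *)
Definition beta_winning (sigma : seq (set X) -> set X) : Prop :=
  forall As : nat -> set X, (forall n, born BB (As n)) ->
    ~ has_open_discrete_expansion (fun n => sigma (mkseq As n)).

Definition beta_has_winning_strategy : Prop :=
  exists2 sigma, beta_strategy sigma & beta_winning sigma.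

End Game.

(* Main.v *)
(* Given a strategy of beta, the condition "f is within 1/3 of n on the n-th
   move of beta" can be imposed successively: inside a nonempty open set V around
   f, let alpha answer with A such that [A; e]^s[f] is contained in V; since the
   next move B of beta is far from A, f can be changed to the constant n + 1 near
   B without leaving V. As in Oxtoby's characterization of Baire spaces by the
   Choquet game, Baire category yields one infinite play and one continuous f that
   satisfies all these conditions at once. The open sets |f - n| < 1/3 then form a
   discrete expansion of the moves of beta, who therefore loses that play. *)
Require Import Defs.
From mathcomp Require Import all_boot all_order all_algebra.
From mathcomp Require Import all_classical all_reals all_analysis.
From mathcomp Require Import lra.

Set Implicit Arguments.
Unset Strict Implicit.
Unset Printing Implicit Defensive.

Import Order.TTheory GRing.Theory Num.Theory.
Import numFieldNormedType.Exports.

Local Open Scope classical_set_scope.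
Local Open Scope ring_scope.

Section Branch.
Variables (T : topologicalType) (S : Type).
Variables (P : set S) (W : S -> set T) (succ : S -> S -> Prop).
Hypothesis openW : forall s, P s -> open (W s).
Hypothesis refine : forall s, P s -> forall V, open V -> V !=set0 ->
  V `<=` W s -> exists s', [/\ P s', succ s s', W s' `<=` V & W s' !=set0].

(** Disjointness concerns indices: a point lying in some [W t] determines the index [t], not merely
    the set. *)
Definition disjoint_successors (s : S) (F : set S) : Prop :=
  (forall t, F t -> [/\ P t, succ s t & W t `<=` W s]) /\
  (forall t u x, F t -> F u -> W t x -> W u x -> t = u).

(** Zorn's lemma gives a maximal disjoint family. If all its sets missed some [V], [refine] would
    give a successor inside [V] that could still be added. *)
Lemma dense_disjoint_successors (s : S) : P s ->
  exists2 F, disjoint_successors s F &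
    forall V, open V -> V !=set0 -> V `<=` W s ->
      exists2 t, F t & W t `&` V !=set0.
Proof.
move=> Ps.
have [|F [[Fs Fdisj] Fmax]] := @Zorn_bigcup _ (disjoint_successors s).
  move=> C CP Ctot; split=> [t [F CF Ft]|t u x [F CF Ft] [G CG Gu]].
    exact: (CP _ CF).1.
  have [FG|GF] := Ctot _ _ CF CG; first exact: (CP _ CG).2 (FG _ Ft) Gu.
  exact: (CP _ CF).2 Ft (GF _ Gu).
exists F => // V oV V0 VW; apply: contrapT => noF.
have [t [Pt st tV [y Wty]]] := refine Ps oV V0 VW.
have FtV u x : F u -> W u x -> W t x -> False.
  by move=> Fu Wux /tV Vx; apply: noF; exists u => //; exists x.
apply: (Fmax (F `|` [set t])).
  split=> [u Fu|Ft]; first by left.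
  by apply: (FtV t y) => //; apply: Ft; right.
split=> [u [/Fs//|->]|u v x [Fu|->] [Fv|->] Wu Wv //].
- by split=> // x /tV /VW.
- exact: Fdisj Fu Fv Wu Wv.
- by case: (FtV u x).
- by case: (FtV v x).
Qed.

(* By disjointness, the point common to the dense levels of the tree of chosen
   successors singles out one branch. *)
Lemma baire_branch (s0 : S) : baire_space T -> P s0 -> W s0 !=set0 ->
  exists2 s_ : nat -> S,
    s_ 0%N = s0 /\ forall n, P (s_ n) /\ succ (s_ n) (s_ n.+1) &
    (\bigcap_n W (s_ n)) !=set0.
Proof.
move=> baireT Ps0 W0.
have /choice[F FP] : forall s, exists F, P s -> disjoint_successors s F /\
    forall V, open V -> V !=set0 -> V `<=` W s ->
      exists2 t, F t & W t `&` V !=set0.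
  move=> s; have [Ps|nPs] := pselect (P s); last by exists set0.
  by have [F ? ?] := dense_disjoint_successors Ps; exists F.
pose L n := iter n (fun A => \bigcup_(s in A) F s) [set s0].
have LP n s : L n s -> P s.
  elim: n s => [_ -> //|n IH s [t /IH Pt Fts]].
  by have [[/(_ _ Fts)[]]] := FP _ Pt.
(* By induction: the sets of the two parents also contain [x], so the parents coincide, and siblings
   are disjoint. *)
have Ldisj n s t x : L n s -> L n t -> W s x -> W t x -> s = t.
  elim: n s t => [_ _ -> -> //|n IH s t [s' Ls' Fs] [t' Lt' Ft] Ws Wt].
  have [[Fs1 Fs2] _] := FP _ (LP _ _ Ls').
  have [[Ft1 _] _] := FP _ (LP _ _ Lt').
  have st' : s' = t'.
    apply: IH => //; first by have [_ _] := Fs1 _ Fs; apply.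
    by have [_ _] := Ft1 _ Ft; apply.
  by apply: Fs2 Fs _ Ws Wt; rewrite st'.
pose U n := \bigcup_(s in L n) W s.
have oU n : open (U n) by apply: bigcup_open => s /LP; exact: openW.
have denseU n V : open V -> V !=set0 -> V `<=` W s0 -> U n `&` V !=set0.
  move=> oV [v Vv] VW; elim: n => [|n [x [[s Ls Wsx] Vx]]].
    by exists v; split=> //; exists s0 => //; exact: VW.
  have Ps := LP _ _ Ls; have [_ Fdense] := FP _ Ps.
  have [||y []//|t Ft [y [Wty [_ Vy]]]] := Fdense (W s `&` V).
  - by apply: openI => //; exact: openW.
  - by exists x.
  by exists y; split=> //; exists t => //; exists s.
(* The levels are dense only inside [W s0]. Adding the exterior of [W s0] makes them dense in [T]
   without affecting points of [W s0]. *)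
have /baireT : forall n, open (U n `|` ~` closure (W s0)) /\
    dense (U n `|` ~` closure (W s0)).
  move=> n; split.
    by apply: openU => //; rewrite openC; exact: closed_closure.
  move=> O [y Oy] oO; have [WO|WO] := pselect (W s0 `&` O !=set0).
    have [|x []//|x [Ux [_ Ox]]] := denseU n (W s0 `&` O) _ WO.
    - by apply: openI => //; exact: openW.
    by exists x; split=> //; left.
  exists y; split=> //; right => /(_ O); apply/not_implyP; split=> //.
  exact: open_nbhs_nbhs.
move=> /(_ _ W0 (openW Ps0))[x [W0x Dx]].
have /choice[s_ s_P] n : exists s, L n s /\ W s x.
  have [[s Ls Ws]|] := Dx n I; first by exists s.
  by move/(_ (subset_closure W0x)).
exists s_; last by exists x => n _; exact: (s_P n).2.
split; first exact: (s_P 0%N).1.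
move=> n; split; first exact: LP (s_P n).1.
(* The parent [t] of [s_ n.+1] has level [n] and its set contains [x], so it is [s_ n]. *)
have [[t Lt Ft] Wx] := s_P n.+1; have [[Ft1 _] _] := FP _ (LP _ _ Lt).
have [_ tsn Wt] := Ft1 _ Ft.
rewrite -(Ldisj n t (s_ n) x) //; first exact: (s_P n).1.
  exact: Wt.
exact: (s_P n).2.
Qed.

End Branch.

Section Game.
Context {R : realType} {X : metricType R} {BB : bornology X}.

Lemma nbhs_strongP (f : strong_fun BB) (V : set (strong_fun BB)) :
  nbhs f V <-> exists B eps,
    [/\ born BB B, 0 < eps & forall g, strong_ent B eps (f, g) -> V g].
Proof.
rewrite -filter_from_entourageE; split.
  move=> [E [[B e] /= [BBB e0] BE] EV]; exists B, e; split=> // g fg.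
  by apply: EV; apply/xsectionP; exact: BE.
move=> [B [e [BBB e0 BV]]]; exists (strong_ent B e); first by exists (B, e).
by move=> g /xsectionP; exact: BV.
Qed.

(** By the triangle inequality, points of the two [r / 3]-enlargements are more than [r / 3] apart,
    so a uniform Urysohn function separates them. *)
Lemma far_separation (A B : set X) : far A B ->
  exists (phi : X -> R) (delta : R), [/\ continuous phi, 0 < delta,
    forall x, enlargement A delta x -> phi x = 0 &
    forall x, enlargement B delta x -> phi x = 1].
Proof.
rewrite /far; set r := inf _ => r0.
have rle a b : A a -> B b -> r <= mdist a b.
  move=> Aa Bb; apply: ge_inf; last by exists a => //; exists b.
  by exists 0 => _ [x _ [y _ <-]]; exact: mdist_ge0.
have r3 : 0 < r / 3 by lra.
have /uniform_separatorW /(@uniform_separatorP _ R) :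
    exists2 E : set (X * X), entourage E &
      (enlargement A (r / 3) `*` enlargement B (r / 3)) `&` E = set0.
  exists [set xy | ball xy.1 (r / 3) xy.2].
    exact: (entourage_ball X (PosNum r3)).
  rewrite -subset0 => -[x y] /= [[[a Aa /= ax] [b Bb /= bx]]].
  rewrite ballEmdist /= => xy; have := rle _ _ Aa Bb.
  have := metric_triangle a x b; have := metric_triangle x y b.
  rewrite (metric_sym a x); lra.
move=> [phi [cphi _ phi0 phi1]]; exists phi, (r / 3); split=> // x Ex.
- by apply: phi0; exists x.
- by apply: phi1; exists x.
Qed.

Lemma far_modification (A B : set X) (f : strong_fun BB) (c : R) : far A B ->
  exists (g : strong_fun BB) (delta : R), [/\ 0 < delta,
    forall x, enlargement A delta x -> g x = c &
    forall x, enlargement B delta x -> g x = f x].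
Proof.
move=> /far_separation[phi [delta [cphi delta0 phi0 phi1]]].
(* Interpolation from [c], where [phi] is 0, to [f], where [phi] is 1. *)
have cg : continuous (fun x => c + phi x * (f x - c)).
  move=> x; have cf : {for x, continuous f} by exact: cts_fun.
  apply: cvgD; first exact: cvg_cst.
  by apply: cvgM; [exact: cphi|apply: cvgB => //; exact: cvg_cst].
exists (mkcts cg), delta; split=> // x Ex.
- by rewrite /= /mkcts phi0// mul0r addr0.
- by rewrite /= /mkcts phi1// mul1r subrKC.
Qed.

Definition close_on (B : set X) (c : R) : set (strong_fun BB) :=
  [set g | forall x, B x -> `|g x - c| < 1 / 3].

Lemma nbhs_close_on (B : set X) (c delta : R) (g : strong_fun BB) :
  born BB B -> 0 < delta -> (forall x, enlargement B delta x -> g x = c) ->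
  nbhs g (close_on B c).
Proof.
move=> BBB delta0 gc; apply/nbhs_strongP; exists B, (1 / 3); split=> //.
move=> h [eta eta0 gh] x Bx.
have Bdx (e : R) : 0 < e -> enlargement B e x.
  by move=> e0; exists x => //=; rewrite mdistxx.
by have := gh x (Bdx _ eta0); rewrite /= (gc x (Bdx _ delta0)) distrC.
Qed.

(** If a set on which [f] stays within 1/6 of [f x] meets the bands around [m] and [n], then [m] and
    [n] differ by less than 1/3 + 1/6 + 1/6 + 1/3 = 1. *)
Lemma open_discrete_expansion (f : X -> R) (B : nat -> set X) :
  continuous f -> (forall n x, B n x -> `|f x - n%:R| < 1 / 3) ->
  has_open_discrete_expansion B.
Proof.
move=> cf fB; exists (fun n => [set x | `|f x - n%:R| < 1 / 3]); split.
- move=> n; rewrite openE => x /= fx.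
  have e0 : 0 < 1 / 3 - `|f x - n%:R| by lra.
  have /cvgrPdist_lt /(_ _ e0) := cf x; apply: filterS => y /= xy.
  have := ler_distD (f x) (f y) n%:R; rewrite (distrC (f y) (f x)); lra.
- exact: fB.
- move=> x; exists [set y | `|f x - f y| < 1 / 6].
    have e0 : 0 < 1 / 6 :> R by lra.
    by have /cvgrPdist_lt /(_ _ e0) := cf x.
  move=> m n [y [/= ym xy]] [z [/= zn xz]].
  have mn : `|m%:R - n%:R| < 1 :> R.
    move: ym xy zn xz; rewrite !ltr_norml; lra.
  have lt1 p q : (p < q)%N -> p%:R + 1 <= q%:R :> R by rewrite natr1 ler_nat.
  move: mn; rewrite ltr_norml.
  by case: (ltngtP m n) => // /lt1 ? ?; exfalso; lra.
Qed.

End Game.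

Theorem theorem5p3 (R : realType) (X : metricType R) (BB : bornology X)
    (BB_closed_base : has_closed_base BB)
    (CX_baire : baire_space (strong_fun BB)) :
  ~ beta_has_winning_strategy BB.
Proof.
move=> [sigma sigmaP sigma_wins].
have born_sigma As : (forall A, A \in As -> born BB A) -> born BB (sigma As).
  by move=> /sigmaP[].
(* A node pairs a history of alpha with an open set of functions that suit the answer of beta to it;
   earlier answers are handled by earlier nodes of the branch. *)
pose P (s : seq (set X) * set (strong_fun BB)) :=
  [/\ forall A, A \in s.1 -> born BB A, open s.2 &
      s.2 `<=` close_on (sigma s.1) (size s.1)%:R].
pose succ (s t : seq (set X) * set (strong_fun BB)) :=
  exists A, t.1 = rcons s.1 A.
have refine s : P s -> forall V, open V -> V !=set0 -> V `<=` s.2 ->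
    exists t, [/\ P t, succ s t, t.2 `<=` V & t.2 !=set0].
  case: s => As W [/= bornAs _ _] V oV [f Vf] _.
  have /nbhs_strongP[A [e [bornA e0 AV]]] : nbhs f V by exact: open_nbhs_nbhs.
  have bornAsA B : B \in rcons As A -> born BB B.
    by rewrite mem_rcons inE => /predU1P[->//|]; exact: bornAs.
  have [bornB farBA] := sigmaP _ bornAsA.
  have {}farBA : far (sigma (rcons As A)) A.
    by case: As farBA {bornAs bornAsA bornB} => //= A0 As; rewrite last_rcons.
  have [g [delta [delta0 gc gf]]] := far_modification f (size As).+1%:R farBA.
  (* Agreement with [f] on a whole enlargement of [A] puts [g] in the strong neighbourhood of [f]
     given by [A] and any [e]. *)
  have Vg : V g.
    by apply: AV; exists delta => // x /gf /= ->; rewrite subrr normr0.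
  (* The interior is taken because [close_on] need not be open; it contains [g], which is constant
     near the move of beta. *)
  exists (rcons As A, V `&` (close_on (sigma (rcons As A)) (size As).+1%:R)°).
  split=> /=; last 1 first.
  - by exists g; split=> //; exact: nbhs_close_on gc.
  - split=> //=; first by apply: openI => //; exact: open_interior.
    by rewrite size_rcons => h [_ /interior_subset].
  - by exists A.
  - exact: subIsetl.
(* The root has an empty history; the zero function suits the opening move, numbered 0. *)
have [s0P s0ne] : P ([::], (close_on (sigma [::]) 0)°) /\
    ((close_on (sigma [::]) 0)° : set (strong_fun BB)) !=set0.
  split; first by split=> //=; [exact: open_interior|exact: interior_subset].
  exists (mkcts (@cst_continuous X R 0)).
  by apply: (nbhs_close_on (delta := 1)) => //; exact: born_sigma.
have oP s : P s -> open s.2 by case.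
have [s_ [s_0 s_P] [f fs]] := baire_branch oP refine CX_baire s0P s0ne.
(* Each history extends the previous one by one move, so the last entries form one infinite play. *)
have /choice[As AsP] n : exists A, (s_ n.+1).1 = rcons (s_ n).1 A.
  by have [_ []] := s_P n => A ->; exists A.
have s_E n : (s_ n).1 = mkseq As n.
  by elim: n => [|n IH]; [rewrite s_0|rewrite AsP IH mkseqS].
apply: (sigma_wins As) => [n|].
  have [[+ _ _] _] := s_P n.+1; apply.
  by rewrite AsP mem_rcons inE eqxx.
apply: (open_discrete_expansion (f := f)); first exact: cts_fun.
move=> n; have [[_ _ /(_ _ (fs n I)) fn] _] := s_P n; move: fn.
by rewrite /close_on /= s_E size_mkseq; exact.
Qed.
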